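(* Let $P$ be a finite bounded poset and $K$ a field. Then the incidence algebra $KP$ is $2$-Gorenstein if and only if $P$ is dissective, i.e. the Dedekind–MacNeille completion of $P$ is a distributive lattice.
   Context: A poset is bounded if it has a unique minimal and a unique maximal element. The Hasse quiver $Q_P$ has vertices the elements of $P$ and an arrow $x\to y$ iff $y$ covers $x$. The incidence algebra $KP$ is $KQ_P/I$ where $I$ is generated by all differences $w_1-w_2$ of paths of length $\ge2$ with the same start and end. Modules are finitely generated right modules. Let $0\to A\to I^0\to I^1\to\cdots$ be a minimal injective coresolution of $A_A$; $A$ is $2$-Gorenstein if $\operatorname{pd}I^0\le 0$ and $\operatorname{pd}I^1\le 1$. The Dedekind–MacNeille completion of $P$ is the smallest lattice into which $P$ order-embeds. *)

(* Defs.v *)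
From HB Require Import structures.
From mathcomp Require Import all_boot all_order all_algebra.
Set Implicit Arguments. Unset Strict Implicit. Unset Printing Implicit Defensive.
Import Order.Theory GRing.Theory.
Local Open Scope ring_scope.

(* Finitely generated right modules over the incidence algebra KP, presented  *)
(* as finite-dimensional K-linear representations of the poset P (i.e. of    *)
(* the bound quiver (Q_P, I)): a space M_x = K^(rdim x) (row vectors) at each *)
(* x, and for x <= y a linear map M_x -> M_y given by right multiplication by *)
(* rmap x y, functorially (commutativity relations = the ideal I).           *)
Section Rep.
Variables (K : fieldType) (d : Order.disp_t) (P : finPOrderType d).

Record rep := Rep {
  rdim : P -> nat;
  rmap : forall x y : P, 'M[K]_(rdim x, rdim y) }.

Definition is_rep (M : rep) : Prop :=
  [/\ (forall x, rmap M x x = 1%:M),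
      (forall x y z, (x <= y)%O -> (y <= z)%O ->
        rmap M x y *m rmap M y z = rmap M x z)
    & (forall x y, ~~ (x <= y)%O -> rmap M x y = 0)].

Definition hom (M N : rep) := forall x : P, 'M[K]_(rdim M x, rdim N x).

Definition is_hom (M N : rep) (f : hom M N) : Prop :=
  forall x y, (x <= y)%O -> rmap M x y *m f y = f x *m rmap N x y.

Definition comp (L M N : rep) (f : hom L M) (g : hom M N) : hom L N :=
  fun x => f x *m g x.

Definition mono (M N : rep) (f : hom M N) : Prop := forall x, row_free (f x).
Definition epi (M N : rep) (f : hom M N) : Prop := forall x, row_full (f x).

Definition exact_at (L M N : rep) (f : hom L M) (g : hom M N) : Prop :=
  forall x, (kermx (g x) == f x)%MS.

Definition projective (M : rep) : Prop :=
  forall (N L : rep) (g : hom N L) (f : hom M L),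
    is_rep N -> is_rep L -> is_hom g -> is_hom f -> epi g ->
    exists h : hom M N, is_hom h /\ forall x, h x *m g x = f x.

Definition injective (M : rep) : Prop :=
  forall (N L : rep) (g : hom L N) (f : hom L M),
    is_rep N -> is_rep L -> is_hom g -> is_hom f -> mono g ->
    exists h : hom N M, is_hom h /\ forall x, g x *m h x = f x.

Definition pd_le (M : rep) (n : nat) : Prop :=
  exists (Q : nat -> rep) (dd : forall i, hom (Q i.+1) (Q i)) (e : hom (Q 0%N) M),
    [/\ (forall i, is_rep (Q i) /\ projective (Q i)),
        (forall i, is_hom (dd i)),
        (is_hom e /\ epi e),
        (exact_at (dd 0%N) e /\ (forall i, exact_at (dd i.+1) (dd i)))
      & (forall i x, (n < i)%N -> rdim (Q i) x = 0%N)].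

(* The regular right module A_A = (+)_x e_x KP, as a representation:           *)
(* at y it has basis {x | x <= y} (paths x ~> y), and for y <= z the structure *)
(* map is the inclusion of bases.                                             *)
Definition downset (y : P) : {set P} := [set x : P | (x <= y)%O].

Definition regular : rep :=
  @Rep (fun y => #|downset y|)
    (fun y z => if (y <= z)%O then
                  \matrix_(i, j) ((enum_val i : P) == enum_val j)%:R
                else 0).

(* Start of a minimal injective coresolution 0 -> A -> I0 -> I1 -> ... of A_A:*)
(* A -> I0 is an injective envelope, and coker(A -> I0) ~ im d0 -> I1 is an   *)
(* injective envelope (essential monomorphisms into injectives).              *)
Definition min_inj_coresolution_start (I0 I1 : rep)
    (iota : hom regular I0) (d0 : hom I0 I1) : Prop :=
  [/\ (is_rep I0 /\ is_rep I1) /\ (is_hom iota /\ is_hom d0),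
      injective I0 /\ injective I1,
      mono iota /\ exact_at iota d0,
      (forall (N : rep) (g : hom I0 N), is_rep N -> is_hom g ->
          mono (comp iota g) -> mono g)
    & (forall (N : rep) (g : hom I1 N), is_rep N -> is_hom g ->
          (forall x, (kermx (d0 x *m g x) <= kermx (d0 x))%MS) -> mono g)].

Definition two_Gorenstein : Prop :=
  forall (I0 I1 : rep) (iota : hom regular I0) (d0 : hom I0 I1),
    min_inj_coresolution_start iota d0 -> pd_le I0 0 /\ pd_le I1 1.

End Rep.

(* Dedekind-MacNeille completion: the cuts A = lb(ub A), ordered by          *)
(* inclusion; meet = intersection, join B C = lb(ub(B u C)).                 *)
Section DM.
Variables (d : Order.disp_t) (P : finPOrderType d).

Definition ubs (A : {set P}) : {set P} := [set y | [forall x in A, (x <= y)%O]].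
Definition lbs (B : {set P}) : {set P} := [set x | [forall y in B, (x <= y)%O]].
Definition is_cut (A : {set P}) : bool := lbs (ubs A) == A.
Definition cut_join (A B : {set P}) : {set P} := lbs (ubs (A :|: B)).

Definition dissective : Prop :=
  forall A B C : {set P}, is_cut A -> is_cut B -> is_cut C ->
    A :&: cut_join B C = cut_join (A :&: B) (A :&: C).

Definition minimal (m : P) : Prop := forall x : P, (x <= m)%O -> x = m.
Definition maximal (m : P) : Prop := forall x : P, (m <= x)%O -> x = m.
Definition bounded : Prop := (exists! m, minimal m) /\ (exists! m, maximal m).
End DM.

(* Main.v *)
Require Import Defs.
From mathcomp Require Import all_boot all_order all_algebra.
(** For x <= y in P, the projective P_x is constant on the up-set of x and the
    injective I_m on the down-set of m.  With bottom 0 and top 1, P_0 = I_1 is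
    projective-injective and contains every P_x essentially, so I^0 is a sum of
    copies of P_0.  The cokernel of P_x -> P_0 lives on the complement of the
    up-set of x and its socle sits at the elements m maximal in that complement,
    so I^1 is the sum of the I_m over all such pairs (x, m).  The kernel K_U of
    P_0 -> I_m lives on U = P \ (down-set of m), hence pd I_m <= 1 iff K_U is
    projective iff U has a least element.  Thus KP is 2-Gorenstein iff P \ (down
    m) is a principal up-set for all m maximal avoiding some x; on the side of
    cuts, this says that these m are meet-prime, i.e. distributivity. *)

(* MathComp shadows some names of Defs (hom, comp). *)
Import Defs.
Set Implicit Arguments. Unset Strict Implicit. Unset Printing Implicit Defensive.
Import Order.Theory GRing.Theory.
Local Open Scope ring_scope.

(** * Extremal elements of finite posets *)

Lemma exists_minimal_below d (P : finPOrderType d) (S : pred P) (x : P) :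
  S x -> exists m, [/\ (m <= x)%O, S m & forall y, S y -> (y <= m)%O -> y = m].
Proof.
move=> Sx; pose Sx' := [pred m | S m && (m <= x)%O].
have Sx'x : Sx' x by rewrite /= Sx lexx.
(* A down-set of least size forces minimality. *)
case: (arg_minnP (fun m : P => #|downset m|) Sx'x) => m /andP[Sm lemx] minm.
exists m; split=> // y Sy leym; apply/eqP; rewrite eq_le leym /=.
have := minm y; rewrite /= Sy (le_trans leym lemx) => /(_ isT) lemy.
have sub : downset y \subset downset m.
  by apply/subsetP=> w; rewrite !inE => /le_trans; apply.
have /setP/(_ m) : downset y = downset m by apply/eqP; rewrite eqEcard sub.
by rewrite !inE lexx.
Qed.

Lemma exists_maximal_above d (P : finPOrderType d) (S : pred P) (x : P) :
  S x -> exists m, [/\ (x <= m)%O, S m & forall y, S y -> (m <= y)%O -> y = m].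
Proof. exact: (@exists_minimal_below _ P^d). Qed.

(** * Cuts and distributivity *)

Section Combinatorics.
Variables (d : Order.disp_t) (P : finPOrderType d).
Implicit Types (x y z m w : P) (A B C : {set P}).

Lemma bounded_bot_top : bounded P ->
  (exists b, forall x, (b <= x)%O) /\ (exists t, forall x, (x <= t)%O).
Proof.
case=> -[b [_ ub]] [t [_ ut]]; split.
  exists b => x; have [m [lemx _ minm]] := @exists_minimal_below _ P predT x isT.
  by rewrite (ub m) // => y; apply: minm.
exists t => x; have [m [lexm _ maxm]] := @exists_maximal_above _ P predT x isT.
by rewrite (ut m) // => y; apply: maxm.
Qed.

Definition max_avoiding x m : bool :=
  ~~ (x <= m)%O && [forall w, (m < w)%O ==> (x <= w)%O].

Lemma max_avoidingP x m :
  reflect (~~ (x <= m)%O /\ forall w, (m < w)%O -> (x <= w)%O)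
          (max_avoiding x m).
Proof.
apply: (iffP andP) => -[nxm maxm]; split=> //.
  by move=> w; have /implyP := forallP maxm w.
by apply/forallP=> w; apply/implyP/maxm.
Qed.

Lemma max_avoiding_above x y :
  ~~ (x <= y)%O -> exists2 m, (y <= m)%O & max_avoiding x m.
Proof.
move/(@exists_maximal_above _ P (fun w => ~~ (x <= w)%O)) => [m [leym nxm maxm]].
exists m => //; apply/max_avoidingP; split=> // w ltmw.
apply: contraTT ltmw => nxw; rewrite lt_neqAle negb_and negbK.
by case: (boolP (m <= w)%O) => [/(maxm w nxw) -> |]; rewrite ?eqxx ?orbT.
Qed.

(** Splitting of [P] into the down-set of [m] and a principal up-set. *)
Definition codissector m := exists z, forall w, (z <= w)%O = ~~ (w <= m)%O.

Lemma mem_lbs_ubs A x :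
  reflect (forall y, (forall a, a \in A -> (a <= y)%O) -> (x <= y)%O)
          (x \in lbs (ubs A)).
Proof.
rewrite inE; apply: (iffP forall_inP) => h y.
  by move=> Ay; apply: h; rewrite inE; apply/forall_inP.
by rewrite inE => /forall_inP; apply: h.
Qed.

Lemma sub_lbs_ubs A x : x \in A -> x \in lbs (ubs A).
Proof. by move=> Ax; apply/mem_lbs_ubs=> y; apply. Qed.

Lemma down_closed_cut A x y : is_cut A -> x \in A -> (y <= x)%O -> y \in A.
Proof.
move=> /eqP <- /mem_lbs_ubs Ax leyx; apply/mem_lbs_ubs=> z hz.
exact: le_trans leyx (Ax z hz).
Qed.

Lemma cut_lbs_ubs A : is_cut (lbs (ubs A)).
Proof.
apply/eqP/setP=> x; apply/idP/idP => [/mem_lbs_ubs h|]; last exact: sub_lbs_ubs.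
by apply/mem_lbs_ubs=> y Ay; apply: h => a /mem_lbs_ubs; apply.
Qed.

Lemma cut_downset x : is_cut (downset x).
Proof.
apply/eqP/setP=> y; apply/idP/idP => [/mem_lbs_ubs h|]; last exact: sub_lbs_ubs.
by rewrite inE; apply: h => a; rewrite inE.
Qed.

Lemma cutI A B : is_cut A -> is_cut B -> is_cut (A :&: B).
Proof.
move=> /eqP cA /eqP cB; apply/eqP/setP=> x.
apply/idP/idP => [/mem_lbs_ubs h|]; last exact: sub_lbs_ubs.
rewrite inE -{1}cA -{1}cB; apply/andP; split; apply/mem_lbs_ubs=> y hy; apply: h.
  by move=> a /setIP[/hy].
by move=> a /setIP[_ /hy].
Qed.

(** Distributivity makes U, the complement of the down-set of [m], down-directed; being finite and
    nonempty, U then has a least element. *)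
Lemma dissective_codissector x m :
  dissective P -> max_avoiding x m -> codissector m.
Proof.
move=> dis /max_avoidingP[nxm maxm].
(* An upper bound of [m] and [v] lies strictly above [m], hence above [x]. *)
have inj v : ~~ (v <= m)%O -> x \in cut_join (downset m) (downset v).
  move=> nvm; apply/mem_lbs_ubs=> y hy; apply: maxm.
  have lemy : (m <= y)%O by apply: hy; rewrite !inE lexx.
  have levy : (v <= y)%O by apply: hy; rewrite !inE lexx orbT.
  by rewrite lt_neqAle lemy andbT; apply: contraNneq nvm => ->.
have down v w : ~~ (v <= m)%O -> ~~ (w <= m)%O ->
    exists u, [/\ (u <= v)%O, (u <= w)%O & ~~ (u <= m)%O].
  move=> nvm nwm; case: (pickP (fun u => [&& u <= v, u <= w & ~~ (u <= m)]%O)).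
    by move=> u /and3P[]; exists u.
  move=> noU; case/negP: nxm.
  (* Without a common lower bound of [v] and [w] in U, b = b meet (a join c) = (b meet a) join (b
     meet c) lies below [m], and with it x, which is below a join b. *)
  pose a := downset x :&: downset m; pose b := downset x :&: downset v.
  pose c := downset x :&: downset w.
  have xab : x \in cut_join a b.
    rewrite -dis ?cut_downset //; apply/setIP; split; last exact: inj.
    by rewrite inE lexx.
  have ac : cut_join a c = downset x :&: cut_join (downset m) (downset w).
    by rewrite -dis ?cut_downset.
  have cutx y : is_cut (downset x :&: downset y) by rewrite cutI ?cut_downset.
  have sba y : y \in b -> (y <= m)%O.
    move=> yb; have : y \in b :&: cut_join a c.
      rewrite inE yb ac inE; have /setIP[-> _] := yb.
      apply: (@down_closed_cut _ x); [exact: cut_lbs_ubs | exact: inj |].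
      by have /setIP[] := yb; rewrite inE.
    rewrite dis ?cutx // => /mem_lbs_ubs; apply=> w'.
    rewrite !inE; case/orP.
      by case/andP=> _ /andP[].
    case/andP=> /andP[_ wv] /andP[_ ww]; have := noU w'.
    by rewrite wv ww /= => /negbFE.
  move/mem_lbs_ubs: xab; apply=> y /setUP[]; last exact: sba.
  by rewrite !inE => /andP[].
have [z [_ nzm minz]] :=
  @exists_minimal_below _ P (fun w => ~~ (w <= m)%O) x nxm.
exists z => w; apply/idP/idP.
  by move=> lezw; apply: contra nzm; apply: le_trans.
move=> nwm; have [u [uz uw num]] := down _ _ nzm nwm.
by rewrite -(minz u num uz).
Qed.

(** Only one inclusion is special to distributive lattices. If it fails at [x], some [m] maximal
    avoiding [x] bounds the right-hand side. A cut not below [m] contains its [z]; so [z] is in [A]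
    but in neither [B] nor [C], both of these lie below [m], and so does [x], a contradiction. *)
Lemma codissector_dissective :
  (forall x m, max_avoiding x m -> codissector m) -> dissective P.
Proof.
move=> cod A B C cA cB cC; apply/setP=> x; apply/idP/idP; last first.
  move=> /mem_lbs_ubs h; rewrite inE -{1}(eqP cA); apply/andP.
  split; apply/mem_lbs_ubs=> y hy; apply: h => a; rewrite !inE -andb_orr.
    by case/andP=> Aa _; apply: hy.
  by case/andP=> _ BCa; apply: hy; rewrite inE.
case/setIP=> Ax /mem_lbs_ubs BCx; apply/mem_lbs_ubs=> y hy.
apply: contraT => nxy; have [m leym maxm] := max_avoiding_above nxy.
have [z hz] := cod _ _ maxm; have /max_avoidingP[nxm _] := maxm.
have Az : z \in A by apply: (down_closed_cut cA Ax); rewrite hz.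
have zBC D : is_cut D -> z \notin D -> forall a, a \in D -> (a <= m)%O.
  move=> cD nzD a Da; apply: contraNT nzD => nam.
  by apply: (down_closed_cut cD Da); rewrite hz.
have nz : (z <= m)%O -> False by move=> zm; have := lexx z; rewrite hz zm.
case: (boolP (z \in B)) => [Bz|nBz].
  by case: nz; apply: le_trans leym; apply: hy; rewrite !inE Az Bz.
case: (boolP (z \in C)) => [Cz|nCz].
  by case: nz; apply: le_trans leym; apply: hy; rewrite !inE Az Cz orbT.
case/negP: nxm; apply: BCx => a /setUP[]; first exact: zBC nBz a.
exact: zBC nCz a.
Qed.

End Combinatorics.

(* Otherwise rewriting with mulmxA unfolds pinvmx and row_base into products. *)
Local Opaque pinvmx row_base.

(** * Images, lifting and extension of morphisms *)

Section Representations.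
Variables (K : fieldType) (d : Order.disp_t) (P : finPOrderType d).
Implicit Types L M N : rep K P.

Lemma row_free_mull (m n p : nat) (A : 'M[K]_(m, n)) (B : 'M[K]_(n, p)) :
  row_free (A *m B) -> row_free A.
Proof.
rewrite /row_free => /eqP fAB; rewrite eqn_leq rank_leq_row -{1}fAB.
exact: mxrankM_maxl.
Qed.

Lemma row_free_mulmx (m n p : nat) (A : 'M[K]_(m, n)) (B : 'M[K]_(n, p)) :
  row_free A -> row_free B -> row_free (A *m B).
Proof. by move=> fA fB; rewrite /row_free mxrankMfree. Qed.

Lemma sub_kermx_mul (m n p q : nat) (A : 'M[K]_(m, n)) (B : 'M[K]_(m, p))
    (C : 'M[K]_(q, m)) :
  (kermx A <= kermx B)%MS -> C *m A = 0 -> C *m B = 0.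
Proof. by move=> sAB /sub_kermxP CA; apply/sub_kermxP/(submx_trans CA). Qed.

Lemma mulmx_pinv_ker (m n p : nat) (A : 'M[K]_(m, n)) (B : 'M[K]_(m, p)) :
  (kermx A <= kermx B)%MS -> A *m pinvmx A *m B = B.
Proof.
move=> sAB; apply/eqP; rewrite -subr_eq0 -{2}[B]mul1mx -mulmxBl; apply/eqP.
by apply: (sub_kermx_mul sAB); rewrite mulmxBl mul1mx mulmxKpV ?subrr.
Qed.

Lemma is_hom_comp L M N (f : hom L M) (g : hom M N) :
  is_hom f -> is_hom g -> is_hom (comp f g).
Proof.
by move=> hf hg x y lexy; rewrite /comp mulmxA hf // -!mulmxA hg.
Qed.

Section Image.
Variables (L N : rep K P) (g : hom L N).
Hypotheses (rN : is_rep N) (hg : is_hom g).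

(** [row_base (g x)] is a basis of the image at [x]; [pinvmx] reads off coordinates in it. *)
Definition image_rep : rep K P :=
  @Rep K d P (fun x => \rank (g x))
    (fun x y => row_base (g x) *m rmap N x y *m pinvmx (row_base (g y))).

Definition image_incl : hom image_rep N := fun x => row_base (g x).
Definition image_proj : hom L image_rep :=
  fun x => g x *m pinvmx (row_base (g x)).

Lemma image_incl_mono : mono image_incl.
Proof. by move=> x; apply: row_base_free. Qed.

Lemma image_projK x : image_proj x *m image_incl x = g x.
Proof. by rewrite mulmxKpV // eq_row_base. Qed.

Lemma image_incl_hom : is_hom image_incl.
Proof.
move=> x y lexy; rewrite /= mulmxKpV // eq_row_base.
have [u ->] : exists u, row_base (g x) = u *m g x.
  by apply/submxP; rewrite eq_row_base.
by rewrite -mulmxA -hg // mulmxA submxMl.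
Qed.

Lemma image_repP : is_rep image_rep.
Proof.
have [N1 N2 N3] := rN; split=> [x|x y z lexy leyz|x y nlexy] /=.
- by rewrite N1 mulmx1 mulmxVp // row_base_free.
- have E : row_base (g x) *m rmap N x y *m pinvmx (row_base (g y)) *m
      row_base (g y) = row_base (g x) *m rmap N x y by apply: image_incl_hom.
  rewrite (mulmxA _ (row_base (g y) *m rmap N y z)) (mulmxA _ (row_base (g y))).
  by rewrite E -(mulmxA _ (rmap N x y)) N2.
- by rewrite N3 // mulmx0 mul0mx.
Qed.

Lemma image_proj_hom : is_hom image_proj.
Proof.
move=> x y lexy; apply: (row_free_inj (image_incl_mono y)).
rewrite -(mulmxA (rmap L x y)) image_projK hg // -(mulmxA (image_proj x)).
by rewrite image_incl_hom // (mulmxA (image_proj x)) image_projK.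
Qed.

Lemma image_proj_epi : epi image_proj.
Proof.
move=> x; rewrite /row_full eqn_leq rank_leq_col /=.
by rewrite -{1}(image_projK x) mxrankM_maxl.
Qed.

End Image.

(** Corestrict [f] and [g] to the image of [g], where [g] becomes epi. *)
Lemma projective_lift (Q N L : rep K P) (g : hom N L) (f : hom Q L) :
  projective Q -> is_rep N -> is_rep L -> is_hom g -> is_hom f ->
  (forall x, (f x <= g x)%MS) ->
  exists h : hom Q N, is_hom h /\ forall x, h x *m g x = f x.
Proof.
move=> pQ rN rL hg hf sfg.
pose f' : hom Q (image_rep g) := fun x => f x *m pinvmx (row_base (g x)).
have f'K x : f' x *m image_incl g x = f x by rewrite mulmxKpV // eq_row_base.
have hf' : is_hom f'.
  move=> x y lexy; apply: (row_free_inj (image_incl_mono g y)).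
  rewrite -(mulmxA (rmap Q x y)) f'K hf // -(mulmxA (f' x)).
  by rewrite image_incl_hom // (mulmxA (f' x)) f'K.
have [h [hh hK]] := pQ _ _ _ _ rN (image_repP rL hg) (image_proj_hom hg) hf'
  (image_proj_epi g).
by exists h; split=> // x; rewrite -(image_projK g) mulmxA hK f'K.
Qed.

(** Since [f] kills the kernel of [g], it factors through the image of [g], and injectivity extends
    it from there to [N]. *)
Lemma injective_extend (M N L : rep K P) (g : hom L N) (f : hom L M) :
  injective M -> is_rep N -> is_rep L -> is_hom g -> is_hom f ->
  (forall x, (kermx (g x) <= kermx (f x))%MS) ->
  exists h : hom N M, is_hom h /\ forall x, g x *m h x = f x.
Proof.
move=> iM rN rL hg hf sgf.
pose f' : hom (image_rep g) M := fun x => row_base (g x) *m pinvmx (g x) *m f x.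
have hf' : is_hom f'.
  move=> x y lexy.
  have E : row_base (g x) *m rmap N x y *m pinvmx (row_base (g y)) *m
    row_base (g y) = row_base (g x) *m rmap N x y by apply: image_incl_hom.
  rewrite /f' /= (mulmxA _ (row_base _ *m _)) (mulmxA _ (row_base _)) E.
  have [u ->] : exists u, row_base (g x) = u *m g x.
    by apply/submxP; rewrite eq_row_base.
  rewrite -(mulmxA u (g x) (rmap N x y)) -hg // (mulmxA u (rmap L x y)).
  rewrite -(mulmxA _ (g y)) -(mulmxA (u *m rmap L x y)) mulmx_pinv_ker //.
  rewrite -(mulmxA u (rmap L x y)) hf // (mulmxA u (f x)).
  by rewrite -(mulmxA u (g x)) -(mulmxA u (_ *m pinvmx _)) mulmx_pinv_ker.
have [h [hh hK]] := iM _ _ _ _ rN (image_repP rN hg) (image_incl_hom hg) hf'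
  (image_incl_mono g).
exists h; split=> // x; rewrite -{1}(image_projK g) -mulmxA hK /f' /image_proj.
rewrite (mulmxA _ (row_base _ *m _)) (mulmxA _ (row_base _)).
by rewrite mulmxKpV ?eq_row_base // mulmx_pinv_ker.
Qed.

Lemma pd_le_iso M N (h : hom M N) n :
  is_hom h -> mono h -> epi h -> pd_le M n -> pd_le N n.
Proof.
move=> hh mh eh [Q [dd [e [pQ hdd [he ee] [ex0 ex] Q0]]]].
exists Q, dd, (comp e h); split=> //.
  split; first exact: is_hom_comp.
  move=> x; rewrite /row_full mxrankMfree // (eqP (ee x)) -(eqP (mh x)).
  exact: eh.
split=> // x; have /andP[s1 s2] := ex0 x.
rewrite /comp; apply/andP; split.
  apply: submx_trans s1; apply/sub_kermxP; apply: (row_free_inj (mh x)).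
  by rewrite -mulmxA mulmx_ker mul0mx.
apply: (submx_trans s2); apply/sub_kermxP.
by rewrite mulmxA mulmx_ker mul0mx.
Qed.

Lemma mono_rdim_le M N (h : hom M N) x : mono h -> (rdim M x <= rdim N x)%N.
Proof. by move/(_ x)/eqP=> <-; apply: rank_leq_col. Qed.

(** Dimension count at each [x]; it yields isomorphisms without building inverses. *)
Lemma mono_epi M N (h : hom M N) (k : hom N M) : mono h -> mono k -> epi h.
Proof.
move=> mh mk x; rewrite /row_full (eqP (mh x)) eqn_leq.
by rewrite (mono_rdim_le _ mh) (mono_rdim_le _ mk).
Qed.

End Representations.

(** * Matrices with rows and columns labelled by finite sets *)

Section SetMatrices.
Variable K : fieldType.
Implicit Types T U V : finType.

Definition set_mx T U (A : {set T}) (B : {set U}) (a : T -> U -> K) :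
    'M[K]_(#|A|, #|B|) := \matrix_(i, j) a (enum_val i) (enum_val j).

(** [set_mx A B kron] sends a basis vector to itself if its label is in [B], and to 0 otherwise. *)
Definition kron T (i j : T) : K := (i == j)%:R.

Definition set_row T (A : {set T}) (t : T) : 'rV[K]_#|A| :=
  \row_j kron t (enum_val j).

Lemma eq_set_mx T U (A : {set T}) (B : {set U}) (a b : T -> U -> K) :
  {in A & B, a =2 b} -> set_mx A B a = set_mx A B b.
Proof. by move=> eab; apply/matrixP=> i j; rewrite !mxE eab ?enum_valP. Qed.

Lemma set_mx0 T U (A : {set T}) (B : {set U}) (a : T -> U -> K) :
  {in A & B, forall i j, a i j = 0} -> set_mx A B a = 0.
Proof. by move=> a0; apply/matrixP=> i j; rewrite !mxE a0 ?enum_valP. Qed.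

Lemma mul_set_mx T U V (A : {set T}) (B : {set U}) (C : {set V}) a b :
  set_mx A B a *m set_mx B C b =
  set_mx A C (fun i k => \sum_(j in B) a i j * b j k).
Proof.
apply/matrixP=> i k; rewrite !mxE [RHS]big_enum_val.
by apply: eq_bigr => j _; rewrite !mxE.
Qed.

Lemma sum_kronl T (A : {set T}) i (F : T -> K) :
  \sum_(j in A) kron i j * F j = (i \in A)%:R * F i.
Proof.
rewrite big_mkcond (bigD1 i) //= big1 => [|j /negPf ji]; last first.
  by rewrite /kron eq_sym ji mul0r if_same.
by rewrite /kron eqxx mul1r addr0; case: (i \in A); rewrite ?mul1r ?mul0r.
Qed.

Lemma sum_kronr T (A : {set T}) i (F : T -> K) :
  \sum_(j in A) F j * kron j i = F i * (i \in A)%:R.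
Proof.
rewrite mulrC -sum_kronl; apply: eq_bigr => j _.
by rewrite mulrC /kron eq_sym.
Qed.

Lemma mul_kron_mx T U (A B : {set T}) (C : {set U}) b :
  set_mx A B (@kron T) *m set_mx B C b =
  set_mx A C (fun i k => (i \in B)%:R * b i k).
Proof. by rewrite mul_set_mx; apply: eq_set_mx => i k _ _; rewrite sum_kronl. Qed.

Lemma mul_mx_kron T U (A : {set T}) (B C : {set U}) a :
  set_mx A B a *m set_mx B C (@kron U) =
  set_mx A C (fun i k => a i k * (k \in B)%:R).
Proof. by rewrite mul_set_mx; apply: eq_set_mx => i k _ _; rewrite sum_kronr. Qed.

Lemma kron_mx1 T (A : {set T}) : set_mx A A (@kron T) = 1%:M.
Proof.
by apply/matrixP=> i j; rewrite !mxE /kron (inj_eq enum_val_inj).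
Qed.

Lemma mem_enum_val T (A : {set T}) t :
  t \in A -> exists i : 'I_#|A|, t = enum_val i.
Proof. by move=> At; exists (enum_rank_in At t); rewrite enum_rankK_in. Qed.

Lemma set_row_delta T (A : {set T}) (i : 'I_#|A|) :
  set_row A (enum_val i) = delta_mx 0 i.
Proof.
by apply/matrixP=> k j; rewrite !mxE ord1 eqxx /kron (inj_eq enum_val_inj) eq_sym.
Qed.

Lemma row_set_mx T (A : {set T}) n (M : 'M[K]_(#|A|, n)) i :
  row i M = set_row A (enum_val i) *m M.
Proof. by rewrite set_row_delta rowE. Qed.

Lemma col_set_mx T (A : {set T}) n (M : 'M[K]_(n, #|A|)) j :
  col j M = M *m (set_row A (enum_val j))^T.
Proof. by rewrite set_row_delta trmx_delta colE. Qed.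

Lemma set_row_kron T (A B : {set T}) t :
  t \in A -> set_row A t *m set_mx A B (@kron T) = set_row B t.
Proof.
case/mem_enum_val=> i ->; rewrite -row_set_mx.
by apply/matrixP=> k j; rewrite !mxE.
Qed.

Lemma kron_set_row T (A B : {set T}) t :
  t \in B -> set_mx A B (@kron T) *m (set_row B t)^T = (set_row A t)^T.
Proof.
case/mem_enum_val=> i ->; rewrite -col_set_mx.
by apply/matrixP=> j k; rewrite !mxE /kron eq_sym.
Qed.

Lemma kermx_kron T (A B C : {set T}) :
  A :&: B = B :\: C ->
  (kermx (set_mx B C (@kron T)) == set_mx A B (@kron T))%MS.
Proof.
move=> eAB; apply/andP; split; last first.
  apply/sub_kermxP; rewrite mul_kron_mx; apply: set_mx0 => i k Ai Ck.
  rewrite /kron; case: eqP => [eik|]; rewrite ?mulr0 // -eik in Ck *.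
  by have /setP/(_ i) := eAB; rewrite !inE Ai Ck /= => ->; rewrite mul0r.
set D := set_mx B C _.
(* The identity on [B] splits into a part through [C], which vanishes on the kernel, and a part
   through [A]. *)
have E : 1%:M = D *m set_mx C B (@kron T)
    + set_mx B A (@kron T) *m set_mx A B (@kron T).
  rewrite !mul_kron_mx -kron_mx1; apply/matrixP=> i k; rewrite !mxE -mulrDl.
  have /setP/(_ (enum_val i)) := eAB; rewrite !inE enum_valP andbT => ->.
  by case: (_ \in C); rewrite ?addr0 ?add0r mul1r.
rewrite -[X in (X <= _)%MS]mulmx1 E mulmxDr mulmxA mulmx_ker mul0mx add0r mulmxA.
exact: submxMl.
Qed.

Lemma row_free_kron T (A B : {set T}) :
  A \subset B -> row_free (set_mx A B (@kron T)).
Proof.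
move=> /subsetP sAB; apply/row_freeP; exists (set_mx B A (@kron T)).
rewrite mul_kron_mx -kron_mx1; apply: eq_set_mx => i k Ai _.
by rewrite sAB ?mul1r.
Qed.

Lemma row_full_kron T (A B : {set T}) :
  B \subset A -> row_full (set_mx A B (@kron T)).
Proof.
move=> /subsetP sBA; apply/row_fullP; exists (set_mx B A (@kron T)).
rewrite mul_kron_mx -kron_mx1; apply: eq_set_mx => i k Ai _.
by rewrite sBA ?mul1r.
Qed.

End SetMatrices.

(** * Representations with labelled bases *)

Section SetRepresentations.
Variables (K : fieldType) (d : Order.disp_t) (P : finPOrderType d).
Implicit Types T U : finType.
Local Notation kron := (@kron K _).

(* The representation with basis D y at y, a basis vector t being mapped to   *)
(* itself as long as it persists and to 0 afterwards.                         *)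
Definition set_rep T (D : P -> {set T}) : rep K P :=
  @Rep K d P (fun y => #|D y|)
    (fun y z => if (y <= z)%O then set_mx (D y) (D z) kron else 0).

Definition coef_hom T U (D : P -> {set T}) (E : P -> {set U}) (a : T -> U -> K) :
    hom (set_rep D) (set_rep E) := fun y => set_mx (D y) (E y) a.

(** A label that has died never returns, as functoriality requires. *)
Definition interval_supported T (D : P -> {set T}) :=
  forall x y z, (x <= y)%O -> (y <= z)%O -> D x :&: D z \subset D y.

Lemma set_rep_rmap T (D : P -> {set T}) x y :
  (x <= y)%O -> rmap (set_rep D) x y = set_mx (D x) (D y) kron.
Proof. by move=> /= ->. Qed.

Lemma set_repP T (D : P -> {set T}) : interval_supported D -> is_rep (set_rep D).
Proof.
move=> intD; split=> [x|x y z lexy leyz|x y /negPf /= -> //].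
  by rewrite set_rep_rmap ?lexx ?kron_mx1.
rewrite !set_rep_rmap ?(le_trans lexy) // mul_kron_mx.
apply: eq_set_mx => i k Di Dk; have /subsetP/(_ i) := intD _ _ _ lexy leyz.
rewrite inE Di /kron; case: eqP => [eik|_]; last by rewrite mulr0.
by rewrite eik Dk => -> //; rewrite mul1r.
Qed.

Lemma coef_hom_is_hom T U (D : P -> {set T}) (E : P -> {set U}) a :
  (forall x y t u, (x <= y)%O -> t \in D x -> u \in E y ->
     (t \in D y)%:R * a t u = a t u * (u \in E x)%:R) ->
  is_hom (coef_hom D E a).
Proof.
move=> ha x y lexy; rewrite !set_rep_rmap // mul_kron_mx mul_mx_kron.
by apply: eq_set_mx => t u Dt Eu; apply: ha.
Qed.

Lemma kron_hom T (D E : P -> {set T}) :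
  (forall x y t, (x <= y)%O -> t \in D x -> t \in E y ->
     (t \in D y) = (t \in E x)) ->
  is_hom (coef_hom D E kron).
Proof.
move=> DE; apply: coef_hom_is_hom => x y t u lexy Dt Eu.
rewrite mulrC /kron; case: eqP => [tu|]; last by rewrite !mul0r.
by rewrite -tu in Eu *; rewrite (DE x y).
Qed.

(** The basis of the direct sum of the projectives P_(p t) over [t] in [S]; [down_supported] plays
    the same role for the injectives I_(q t). *)
Definition up_supported T (D : P -> {set T}) (S : pred T) (p : T -> P) :=
  forall y t, (t \in D y) = S t && (p t <= y)%O.

Definition down_supported T (D : P -> {set T}) (S : pred T) (q : T -> P) :=
  forall y t, (t \in D y) = S t && (y <= q t)%O.

Lemma up_interval T (D : P -> {set T}) S p :
  up_supported D S p -> interval_supported D.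
Proof.
move=> DE x y z lexy leyz; apply/subsetP=> t; rewrite inE !DE.
by case/andP=> /andP[-> lepx] _; apply: le_trans lexy.
Qed.

Lemma down_interval T (D : P -> {set T}) S q :
  down_supported D S q -> interval_supported D.
Proof.
move=> DE x y z lexy leyz; apply/subsetP=> t; rewrite inE !DE.
by case/andP=> /andP[-> _] /andP[_]; apply: le_trans.
Qed.

(** A morphism from P_(p t) amounts to a vector at [p t], so it suffices to lift the images of the
    generators, to [w t]. *)
Lemma set_rep_projective T (D : P -> {set T}) S p :
  up_supported D S p -> projective (set_rep D).
Proof.
move=> DE N L g f [N1 N2 N3] rL hg hf eg.
pose w t := set_row K (D (p t)) t *m f (p t) *m pinvmx (g (p t)).
pose h : hom (set_rep D) N := fun y =>
  \matrix_i (w (enum_val i) *m rmap N (p (enum_val i)) y).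
have hE y t : t \in D y -> set_row K (D y) t *m h y = w t *m rmap N (p t) y.
  by case/mem_enum_val=> i ->; rewrite -row_set_mx rowK.
have Dle y t : t \in D y -> (p t <= y)%O /\ t \in D (p t).
  by rewrite !DE lexx andbT => /andP[].
exists h; split=> [x y lexy|x]; apply/row_matrixP=> i.
  rewrite !row_set_mx; have := enum_valP i; set t := enum_val i => Dt.
  have [lepx _] := Dle _ _ Dt.
  have Dty : t \in D y by move: Dt; rewrite !DE => /andP[-> /le_trans->].
  rewrite set_rep_rmap // mulmxA set_row_kron // hE // mulmxA hE //.
  by rewrite -mulmxA N2.
rewrite !row_set_mx; have := enum_valP i; set t := enum_val i => Dt.
have [lepx Dtp] := Dle _ _ Dt.
rewrite mulmxA hE // -mulmxA hg // mulmxA mulmxKpV; last exact: submx_full.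
by rewrite -mulmxA -hf // set_rep_rmap // mulmxA set_row_kron.
Qed.

(** Dually, a morphism into I_(q t) amounts to a linear form at [q t]; the column [w t] extends the
    form given by [f] along [g]. *)
Lemma set_rep_injective T (D : P -> {set T}) S q :
  down_supported D S q -> injective (set_rep D).
Proof.
move=> DE N L g f [N1 N2 N3] rL hg hf mg.
pose w t := pinvmx (g (q t)) *m (f (q t) *m (set_row K (D (q t)) t)^T).
pose h : hom N (set_rep D) := fun y =>
  \matrix_(i, j) (rmap N y (q (enum_val j)) *m w (enum_val j)) i 0.
have hE y t : t \in D y -> h y *m (set_row K (D y) t)^T = rmap N y (q t) *m w t.
  case/mem_enum_val=> j ->; rewrite -col_set_mx.
  by apply/matrixP=> i k; rewrite !ord1 !mxE.
have Dle y t : t \in D y -> (y <= q t)%O /\ t \in D (q t).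
  by rewrite !DE lexx andbT => /andP[].
have colP (n : nat) (A : {set T}) (M1 M2 : 'M[K]_(n, #|A|)) :
    (forall t, t \in A -> M1 *m (set_row K A t)^T = M2 *m (set_row K A t)^T) ->
    M1 = M2.
  move=> eM; apply: trmx_inj; apply/row_matrixP=> j; rewrite -!tr_col.
  by rewrite !col_set_mx eM ?enum_valP.
exists h; split=> [x y lexy|x]; apply: colP => t Dt.
  have [leyq _] := Dle _ _ Dt.
  have Dtx : t \in D x by move: Dt; rewrite !DE => /andP[-> /(le_trans lexy)->].
  rewrite set_rep_rmap // -!mulmxA kron_set_row // !hE // mulmxA.
  by rewrite N2.
have [leyq Dtq] := Dle _ _ Dt.
rewrite -!mulmxA hE // mulmxA -hg // -mulmxA (mulmxA (g _)) mulmxVp // mul1mx.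
by rewrite mulmxA hf // -mulmxA set_rep_rmap // kron_set_row.
Qed.

(* A resolution all of whose differentials match equal basis elements. *)
Lemma set_rep_pd_le T (M : P -> {set T}) (Q : nat -> P -> {set T}) S p n :
  (forall i, up_supported (Q i) (S i) (p i)) ->
  (forall x, M x \subset Q 0 x) ->
  (forall x y t, (x <= y)%O -> t \in M y -> t \in Q 0 x -> t \in M x) ->
  (forall x, Q 1 x :&: Q 0 x = Q 0 x :\: M x) ->
  (forall i x y t, (x <= y)%O -> t \in Q i.+1 x -> t \in Q i y -> t \in Q i x) ->
  (forall i x, Q i.+2 x :&: Q i.+1 x = Q i.+1 x :\: Q i x) ->
  (forall i x, (n < i)%N -> Q i x = set0) ->
  pd_le (set_rep M) n.
Proof.
move=> upQ sMQ dM ex0 dQ ex Q0.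
have Qup i x y t : (x <= y)%O -> t \in Q i x -> t \in Q i y.
  by move=> lexy; rewrite !upQ => /andP[-> /le_trans->].
exists (fun i => set_rep (Q i)), (fun i => coef_hom (Q i.+1) (Q i) kron),
  (coef_hom (Q 0) M kron); split.
- move=> i; split; first exact: set_repP (up_interval (upQ i)).
  exact: set_rep_projective (upQ i).
- move=> i; apply: kron_hom => x y t lexy Qx Qy.
  by rewrite (Qup _ _ _ _ lexy Qx) (dQ i x y).
- split; last by move=> x; apply: row_full_kron.
  apply: kron_hom => x y t lexy Qx My.
  by rewrite (Qup _ _ _ _ lexy Qx) (dM x y).
- by split=> [x|i x]; apply: kermx_kron.
- by move=> i x ltni; rewrite /= Q0 ?cards0.
Qed.

End SetRepresentations.

(** * The minimal injective coresolution *)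

Section Coresolution.
Variables (K : fieldType) (d : Order.disp_t) (P : finPOrderType d).
Local Notation kron := (@kron K _).

Lemma regularP : is_rep (regular K P).
Proof.
apply: (@set_repP K d P P (@downset d P)) => x y z lexy leyz.
by apply/subsetP=> t; rewrite !inE => /andP[letx _]; apply: le_trans lexy.
Qed.

(** Injectivity of [J0] extends [jota] along [iota]; essentiality makes the extension mono. It
    carries the image of [iota] onto that of [jota], so it passes to the cokernels, where the
    argument repeats. *)
Lemma min_inj_coresolution_mono (I0 I1 J0 J1 : rep K P)
    (iota : hom (regular K P) I0) (d0 : hom I0 I1)
    (jota : hom (regular K P) J0) (e0 : hom J0 J1) :
  min_inj_coresolution_start iota d0 -> min_inj_coresolution_start jota e0 ->
  (exists2 h : hom I0 J0, is_hom h & mono h) /\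
  (exists2 h : hom I1 J1, is_hom h & mono h).
Proof.
case=> [[[rI0 rI1] [hiota hd0]] [iI0 iI1] [miota exI] essI0 essI1].
case=> [[[rJ0 rJ1] [hjota he0]] [iJ0 iJ1] [mjota exJ] essJ0 essJ1].
have [h [hh hK]] := iJ0 _ _ _ _ rI0 regularP hiota hjota miota.
have mh : mono h.
  by apply: (essI0 _ _ rJ0 hh) => x; rewrite /comp hK; apply: mjota.
split; first by exists h.
have kerI x : (kermx (d0 x) == iota x)%MS := exI x.
have kerJ x : (kermx (e0 x) == jota x)%MS := exJ x.
have sdh x : (kermx (d0 x) <= kermx (h x *m e0 x))%MS.
  have /andP[s _] := kerI x; apply: submx_trans s _; apply/sub_kermxP.
  by rewrite mulmxA hK; apply/sub_kermxP; have /andP[] := kerJ x.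
have [h1 [hh1 h1K]] :=
  injective_extend iJ1 rI1 rI0 hd0 (is_hom_comp hh he0) sdh.
exists h1 => //; apply: (essI1 _ _ rJ1 hh1) => x; rewrite h1K /comp.
apply/rV_subP=> v /sub_kermxP; rewrite mulmxA => /sub_kermxP vh.
have /submxP[u vu] : (v *m h x <= jota x)%MS.
  by have /andP[s _] := kerJ x; apply: submx_trans vh s.
have -> : v = u *m iota x by apply: (row_free_inj (mh x)); rewrite vu -mulmxA hK.
by have /andP[_] := kerI x; apply: submx_trans; apply: submxMl.
Qed.

Lemma pd_le_min_inj_coresolution (I0 I1 J0 J1 : rep K P)
    (iota : hom (regular K P) I0) (d0 : hom I0 I1)
    (jota : hom (regular K P) J0) (e0 : hom J0 J1) m n :
  min_inj_coresolution_start iota d0 -> min_inj_coresolution_start jota e0 ->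
  pd_le I0 m /\ pd_le I1 n -> pd_le J0 m /\ pd_le J1 n.
Proof.
move=> cI cJ [pd0 pd1].
have [[h hh mh] [h1 hh1 mh1]] := min_inj_coresolution_mono cI cJ.
have [[k _ mk] [k1 _ mk1]] := min_inj_coresolution_mono cJ cI.
by split; [apply: pd_le_iso hh mh (mono_epi mh mk) pd0
         | apply: pd_le_iso hh1 mh1 (mono_epi mh1 mk1) pd1].
Qed.

(** Label [x] stands for the copy of P_0 = I_1 enveloping P_x; in [env1_supp], label [(x, m)] stands
    for a copy of I_m. *)
Definition env0_supp (y : P) : {set P} := setT.
Definition env1_supp (y : P) : {set P * P} :=
  [set t | max_avoiding t.1 t.2 && (y <= t.2)%O].

Definition env0_map : hom (regular K P) (set_rep K env0_supp) :=
  coef_hom (@downset d P) env0_supp kron.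
(** The vector labelled [x] goes to the sum of all vectors labelled [(x, m)] at that vertex. *)
Definition env1_map : hom (set_rep K env0_supp) (set_rep K env1_supp) :=
  coef_hom env0_supp env1_supp (fun t u => kron t u.1).

Variable top : P.
Hypothesis le_top : forall x, (x <= top)%O.

Lemma env0_down : down_supported env0_supp predT (fun _ => top).
Proof. by move=> y t; rewrite inE le_top. Qed.

Lemma env1_down :
  down_supported env1_supp (fun t => max_avoiding t.1 t.2) (fun t => t.2).
Proof. by move=> y t; rewrite inE. Qed.

Lemma env0_map_hom : is_hom env0_map.
Proof.
apply: (@kron_hom K d P P (@downset d P) env0_supp) => x y t lexy.
by rewrite !inE => /le_trans->.
Qed.

Lemma env1_map_hom : is_hom env1_map.
Proof.
apply: coef_hom_is_hom => x y t u lexy _; rewrite !inE => /andP[-> /(le_trans lexy)->].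
by rewrite mulr1 mul1r.
Qed.

Lemma env_exact : exact_at env0_map env1_map.
Proof.
move=> y; apply/andP; split; last first.
  apply/sub_kermxP; rewrite mul_kron_mx; apply: set_mx0 => t u.
  rewrite !inE /kron mul1r => lety /andP[/andP[nle _] leyu].
  by case: eqP => // tu; rewrite -tu (le_trans lety leyu) in nle.
(* Unless x <= y, some [m] above [y] is maximal avoiding [x], and [s] recovers [x] from
   [(x, mav x)]. If x <= y, there is no such [m] and the default is taken. *)
pose mav x := odflt x [pick m | (y <= m)%O && max_avoiding x m].
have mavP x : ~~ (x <= y)%O -> (y <= mav x)%O /\ max_avoiding x (mav x).
  move=> nxy; rewrite /mav; case: pickP => [m /andP[] //|noM].
  by have [m leym maxm] := max_avoiding_above nxy; have := noM m; rewrite leym maxm.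
pose s := set_mx (env1_supp y) (env0_supp y)
  (fun u t => kron u (t, mav t) : K).
pose r := set_mx (env0_supp y) (downset y) kron : 'M[K]_(_, _).
have E : 1%:M = env1_map y *m s + r *m env0_map y.
  rewrite mul_kron_mx mul_set_mx -kron_mx1.
  apply/matrixP=> i k; rewrite !mxE.
  move: (enum_val i) (enum_val k) => {}i {}k.
  rewrite sum_kronr !inE /=; case: (boolP (k <= y)%O) => leky.
    have -> : max_avoiding k (mav k) && (y <= mav k)%O = false.
      by apply/negP => /andP[/andP[nle _] /(le_trans leky) le]; case/negP: nle.
    rewrite mulr0 add0r /kron; case: eqP => [->|]; last by rewrite mulr0.
    by rewrite leky mulr1.
  have [-> ->] := mavP _ leky; rewrite mulr1 /kron.
  case: eqP => [->|]; last by rewrite mulr0 addr0.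
  by rewrite (negPf leky) mul0r addr0.
rewrite -[X in (X <= _)%MS]mulmx1 E mulmxDr mulmxA mulmx_ker mul0mx add0r mulmxA.
exact: submxMl.
Qed.

(** At [top] the map [env0_map] is bijective, so [g top] is injective; the injective structure maps
    into [top] carry this back to [y]. *)
Lemma env0_essential (N : rep K P) (g : hom (set_rep K env0_supp) N) :
  is_hom g -> mono (comp env0_map g) -> mono g.
Proof.
move=> hg mg y.
have mtop : row_free (g top).
  pose s := set_mx (env0_supp top) (downset top) kron : 'M[K]_(_, _).
  have -> : g top = s *m (env0_map top *m g top).
    rewrite mulmxA mul_kron_mx -[LHS]mul1mx -kron_mx1; congr (_ *m _).
    by apply: eq_set_mx => i j _ _; rewrite inE le_top mul1r.
  apply: row_free_mulmx (mg top); apply: row_free_kron.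
  by apply/subsetP=> i _; rewrite inE le_top.
apply: (@row_free_mull _ _ _ _ _ (rmap N y top)).
rewrite -hg // set_rep_rmap //; apply: row_free_mulmx mtop.
exact: row_free_kron.
Qed.

(* Downward induction on y: a vector killed by g is killed by every rmap y z,
   y < z, so it lies in the socle, which is contained in the image of env1_map. *)
Lemma env1_essential (N : rep K P) (g : hom (set_rep K env1_supp) N) :
  is_hom g -> (forall x, (kermx (env1_map x *m g x) <= kermx (env1_map x))%MS) ->
  mono g.
Proof.
move=> hg sg y.
have [n] := ubnP #|[set z | y < z]%O|; elim: n y => // n IHn y /ltnSE ltn.
apply: inj_row_free => v vg.
have vz z : (y < z)%O -> v *m rmap (set_rep K env1_supp) y z = 0.
  move=> ltyz; have mz : row_free (g z).
    apply: IHn; apply: leq_trans ltn; apply: proper_card; apply/properP; split.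
      by apply/subsetP=> w; rewrite !inE; apply: lt_trans.
    by exists z; rewrite !inE ?ltxx.
  apply: (row_free_inj mz); rewrite mul0mx -mulmxA hg ?(ltW ltyz) //.
  by rewrite mulmxA vg mul0mx.
have v0 j : (y < (enum_val j).2)%O -> v 0 j = 0.
  set t := enum_val j => ltyt; have := vz _ ltyt.
  rewrite set_rep_rmap ?(ltW ltyt) //.
  have Dt : t \in env1_supp t.2.
    by have := enum_valP j; rewrite !inE lexx andbT => /andP[].
  move/(congr1 (mulmx^~ (set_row K (env1_supp t.2) t)^T)).
  rewrite -mulmxA kron_set_row // set_row_delta trmx_delta -colE mul0mx.
  by move/matrixP/(_ 0 0); rewrite !mxE.
(* By now [v] lives on labels [(x, y)]. For these, [env1_map] sends [x] to [(x, y)] alone: another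
   [(x, m')] would have y < m', hence x <= m'. *)
pose s := set_mx (env1_supp y) (env0_supp y) (fun u t => kron u.1 t : K).
have vs : v = (v *m s) *m env1_map y.
  rewrite -mulmxA mul_set_mx -[LHS]mulmx1; apply/rowP=> j; rewrite !mxE.
  apply: eq_bigr => i _; case: (boolP (y < (enum_val i).2)%O) => [/v0 ->|nlt].
    by rewrite !mul0r.
  rewrite !mxE; congr (_ * _).
  rewrite (sum_kronl (env0_supp y) _ (fun t => kron t (enum_val j).1 : K)).
  rewrite inE mul1r -(inj_eq enum_val_inj) /kron.
  have := enum_valP i; have := enum_valP j.
  move: (enum_val i) (enum_val j) nlt => [a m] [b m'] /=.
  rewrite !inE /= lt_neqAle => nlt /andP[maxb leym'] /andP[maxa leym].
  move: nlt; rewrite leym andbT negbK => /eqP ym; rewrite -ym in maxa leym *.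
  rewrite xpair_eqE; case: eqP => //= ab; rewrite -ab in maxb.
  case: eqP => // nym'; case/max_avoidingP: maxa => _ /(_ m').
  rewrite lt_neqAle leym' andbT; case/max_avoidingP: maxb => nle _.
  by move: nle => /negP nle h; case: nle; apply: h; apply/eqP.
rewrite vs; apply/sub_kermxP; apply: submx_trans (sg y); apply/sub_kermxP.
by rewrite mulmxA -vs.
Qed.

Lemma env_min_inj_coresolution : min_inj_coresolution_start env0_map env1_map.
Proof.
split; [split; split | split | split | |].
- exact: set_repP (down_interval env0_down).
- exact: set_repP (down_interval env1_down).
- exact: env0_map_hom.
- exact: env1_map_hom.
- exact: set_rep_injective env0_down.
- exact: set_rep_injective env1_down.
- by move=> y; apply: row_free_kron; apply: subsetT.
- exact: env_exact.
- by move=> N g _; apply: env0_essential.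
- by move=> N g _; apply: env1_essential.
Qed.

(** * Projective dimensions of the two terms *)

Variable bot : P.
Hypothesis bot_le : forall x, (bot <= x)%O.

Lemma env0_pd_le : pd_le (set_rep K env0_supp) 0.
Proof.
pose Q i (y : P) : {set P} := if i is 0%N then setT else set0.
apply: (@set_rep_pd_le K d P P _ Q (fun i _ => i == 0%N) (fun _ _ => bot)).
- by move=> [|i] y t; rewrite !inE ?bot_le.
- by move=> x; apply: subxx.
- by move=> x y t _ _; rewrite inE.
- by move=> x; rewrite /= set0I setDv.
- by move=> i x y t _; rewrite inE.
- by move=> i x; rewrite /= set0I set0D.
- by case.
Qed.

(** For each pair [t] = (x, m), the sequence 0 -> P_(z t) -> P_0 -> I_m -> 0 is exact. *)
Lemma env1_pd_le :
  (forall x m : P, max_avoiding x m -> codissector m) ->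
  pd_le (set_rep K env1_supp) 1.
Proof.
move=> cod.
pose z (t : P * P) := odflt bot
  [pick z | [forall w, (z <= w)%O == ~~ (w <= t.2)%O]].
have zP t w : max_avoiding t.1 t.2 -> (z t <= w)%O = ~~ (w <= t.2)%O.
  rewrite /z => /cod[z0 z0P]; case: pickP => [z1 /forallP/(_ w)/eqP // |].
  by move/(_ z0)/negP; case; apply/forallP=> w'; rewrite z0P.
pose Q i (y : P) : {set P * P} :=
  match i with
  | 0 => [set t | max_avoiding t.1 t.2]
  | 1 => [set t | max_avoiding t.1 t.2 && ~~ (y <= t.2)%O]
  | _ => set0
  end.
apply: (@set_rep_pd_le K d P _ _ Q
  (fun i t => (i < 2)%N && max_avoiding t.1 t.2)
  (fun i => if i is 1 then z else fun=> bot)).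
- move=> [|[|i]] y t; rewrite !inE ?bot_le ?andbT //=.
  by case: (boolP (max_avoiding _ _)) => // /zP->.
- by move=> x; apply/subsetP=> t; rewrite !inE => /andP[].
- by move=> x y t lexy; rewrite !inE => /andP[-> /(le_trans lexy)->].
- move=> x; apply/setP=> t; rewrite !inE.
  by case: (max_avoiding _ _); rewrite ?andbT ?andbF.
- by move=> [|i] x y t lexy; rewrite !inE // => /andP[].
- move=> [|i] x; apply/setP=> t; rewrite !inE ?andbF //=.
  by case: (max_avoiding _ _).
- by move=> [|[|i]].
Qed.

(* Lifting the generator of I_m gives a : P_0 -> Q_0, and projectivity of Q_0
   gives b : Q_0 -> P_0 over I_m, so a b <> 0.  As Q_1 is projective, dd b lifts
   along the sum G of the P_u (u in U) over K_U.  The elements a_w of Q_0(w),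
   w in U, come from Q_1; the image in G(top) of the preimage of a_top is nonzero
   and lies in the image of every G(w), so an index u in its support is below
   all of U. *)
Lemma pd_le_codissector :
  pd_le (set_rep K env1_supp) 1 ->
  forall x m : P, max_avoiding x m -> codissector m.
Proof.
case=> Q [dd [e [pQ hdd [he ee] [ex0 ex] Q0]]] x0 m max0.
pose t0 := (x0, m).
(* [C], [I] and [G] are P_0, I_m and the sum of the P_u; the shared label [t0] makes the projection
   of I^1 onto I_m a matching of labels. *)
pose C (y : P) : {set P * P} := [set t0].
pose I (y : P) : {set P * P} := [set t | (t == t0) && (y <= m)%O].
pose G (y : P) : {set P} := [set u | ~~ (u <= m)%O && (u <= y)%O].
have upC : up_supported C (pred1 t0) (fun=> bot).
  by move=> y t; rewrite !inE bot_le andbT.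
have upG : up_supported G (fun u => ~~ (u <= m)%O) id by move=> y u; rewrite inE.
have downI : down_supported I (pred1 t0) (fun=> m) by move=> y t; rewrite inE.
have rC := set_repP K (up_interval upC).
have rG := set_repP K (up_interval upG).
have rI := set_repP K (down_interval downI).
have hCI : is_hom (coef_hom C I kron).
  by apply: kron_hom => x y t lexy; rewrite !inE => -> /(le_trans lexy)->.
have hEI : is_hom (coef_hom env1_supp I kron).
  apply: kron_hom => x y t lexy; rewrite !inE => /andP[-> _].
  by case/andP=> /eqP-> /= leym; rewrite eqxx leym (le_trans lexy leym).
have [[rQ0 pQ0] [rQ1 pQ1]] := (pQ 0%N, pQ 1%N).
have [b [hb bK]] : exists b : hom (Q 0%N) (set_rep K C), is_hom b /\
    forall x, b x *m coef_hom C I kron x = comp e (coef_hom env1_supp I kron) x.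
  apply: pQ0 rC rI hCI (is_hom_comp he hEI) _ => x; apply: row_full_kron.
  by apply/subsetP=> t; rewrite !inE => /andP[].
have hGC : is_hom (coef_hom G C (fun _ _ => 1 : K)).
  apply: coef_hom_is_hom => x y u t lexy; rewrite !inE => /andP[-> leux] ->.
  by rewrite (le_trans leux lexy) mulr1.
have ddb0 x : (x <= m)%O -> dd 0%N x *m b x = 0.
  move=> lexm; have fCI : row_free (coef_hom C I kron x).
    by apply: row_free_kron; apply/subsetP=> t; rewrite !inE lexm andbT.
  apply: (row_free_inj fCI); rewrite mul0mx -mulmxA bK /comp mulmxA.
  have /andP[_ /sub_kermxP ->] := ex0 x; exact: mul0mx.
have [c [hc cK]] : exists c : hom (Q 1%N) (set_rep K G), is_hom c /\
    forall x, c x *m coef_hom G C (fun _ _ => 1) x = comp (dd 0%N) b x.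
  apply: projective_lift pQ1 rG rC hGC (is_hom_comp (hdd 0%N) hb) _ => x.
  case: (boolP (x <= m)%O) => [/ddb0|nxm]; first by rewrite /comp => ->; apply: sub0mx.
  apply: submx_full; apply/row_fullP.
  exists (set_mx (C x) (G x) (fun _ u => kron x u)).
  rewrite mul_set_mx -kron_mx1; apply: eq_set_mx => t t'.
  rewrite !inE => /eqP-> /eqP->.
  by rewrite (sum_kronl _ _ (fun=> 1)) inE nxm lexx mulr1 /kron eqxx.
pose a0 := set_row K (env1_supp bot) t0 *m pinvmx (e bot).
have a0e : a0 *m e bot = set_row K (env1_supp bot) t0.
  by rewrite /a0 mulmxKpV //; apply: submx_full (ee bot).
have Et0 : t0 \in env1_supp bot by rewrite inE bot_le max0.
pose aw w := a0 *m rmap (Q 0%N) bot w.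
have lift w : ~~ (w <= m)%O -> exists q, aw w = q *m dd 0%N w.
  move=> nwm; apply/submxP; have /andP[s _] := ex0 w; apply: submx_trans s.
  apply/sub_kermxP; rewrite -mulmxA he // mulmxA a0e set_rep_rmap //.
  rewrite set_row_kron //; apply/rowP=> j; rewrite !mxE /kron.
  by case: eqP (enum_valP j) => // <-; rewrite inE (negPf nwm) andbF.
(* Q_2 vanishes by the dimension bound, so exactness at Q_1 gives injectivity. *)
have free_dd : row_free (dd 0%N top).
  rewrite -kermx_eq0 -mxrank_eq0 -leqn0.
  have /andP[s _] := ex 0%N top; apply: leq_trans (mxrankS s) _.
  by apply: leq_trans (rank_leq_row _) _; rewrite Q0.
have ntop : ~~ (top <= m)%O.
  by case/max_avoidingP: max0 => n _; apply: contra n; apply: le_trans.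
have [q aq] := lift _ ntop.
(* Otherwise [b] kills [a0] at [top], hence at [bot] since [C] is constant; but over [I bot] the
   image of [a0] is the nonzero vector [t0]. *)
have gn0 : q *m c top != 0.
  apply/negP=> /eqP g0; have : a0 *m b bot *m rmap (set_rep K C) bot top = 0.
    rewrite -mulmxA -hb // mulmxA -/(aw top) aq -mulmxA.
    have := cK top; rewrite /comp => <-.
    by rewrite mulmxA g0 mul0mx.
  rewrite set_rep_rmap // -(mul0mx _ (set_mx (C bot) (C top) kron)).
  move/(row_free_inj (row_free_kron K (subxx _))) => ab0.
  have : set_row K (I bot) t0 = 0.
    rewrite -(set_row_kron K _ Et0) -a0e -mulmxA.
    by have := bK bot; rewrite /comp => <-; rewrite mulmxA ab0 mul0mx.
  have : t0 \in I bot by rewrite inE eqxx bot_le.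
  case/mem_enum_val=> i -> /rowP/(_ i); rewrite !mxE /kron eqxx => /eqP.
  by rewrite oner_eq0.
have [j gj] := rV0Pn _ gn0; exists (enum_val j) => w.
have : enum_val j \in G top := enum_valP j.
rewrite inE => /andP[num _]; apply/idP/idP.
  by move=> leuw; apply: contra num; apply: le_trans.
move=> nwm; have [qw aqw] := lift _ nwm; apply: contraNT gj => nuw.
have qE : q = qw *m rmap (Q 1%N) w top.
  apply: (row_free_inj free_dd); rewrite -aq -mulmxA (hdd 0%N) // mulmxA -aqw.
  by have [_ Qc _] := rQ0; rewrite -mulmxA Qc.
rewrite qE -mulmxA hc // mulmxA set_rep_rmap // mxE big1 // => i _.
rewrite !mxE /kron; case: eqP (enum_valP i) => [->|_ _]; last by rewrite mulr0.
by rewrite inE (negPf nuw) andbF.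
Qed.

End Coresolution.

Theorem mainTheorem7 (K : fieldType) (d : Order.disp_t) (P : finPOrderType d) :
  bounded P -> (two_Gorenstein K P <-> dissective P).
Proof.
move=> /bounded_bot_top[[bot bot_le] [top le_top]].
have env := env_min_inj_coresolution K le_top.
(* [two_Gorenstein] ranges over all minimal coresolutions: one direction evaluates it at the
   explicit one, the other transports the bounds from there. *)
split=> [gor | dis I0 I1 iota d0 cI].
  apply: codissector_dissective.
  apply: (@pd_le_codissector K _ _ top le_top bot bot_le).
  by have [_] := gor _ _ _ _ env.
apply: pd_le_min_inj_coresolution env cI _; split.
  exact: (env0_pd_le K bot_le).
by apply: (env1_pd_le K bot_le) => x m; apply: dissective_codissector.
Qed.
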